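(* Let $f\colon \mathbb{N}\to\mathbb{R}^{\geq 0}$ be the function defined in the context. Let $a,b\in\mathbb{N}$ with $a\neq b$ and $f(b)>f(a)$. Then $f(b)-f(a)\geq \frac{1}{|b-a|}$.
   Context: $\mathbb{N}=\{0,1,2,\dots\}$. Let $F_n$ denote the Fibonacci numbers, $F_0=0$, $F_1=1$, $F_n=F_{n-1}+F_{n-2}$ for $n>1$, and let $u_i=F_{2i}$ for $i\geq 1$. Every $N\in\mathbb{N}$ has a unique representation $N=\sum_{i=1}^\infty d_iu_i$ with digits $d_i\in\{0,1,2\}$, only finitely many nonzero, such that whenever $i<j$ and $d_i=d_j=2$ there exists $l$ with $i<l<j$ and $d_l=0$. For $a\in\mathbb{N}$ write $d^a_i$ for the digits of this representation of $a$, and define $f(a)=\sum_{i=1}^\infty \frac{d^a_i}{u_i}$. *)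

(* Defs.v *)
From mathcomp Require Import all_boot all_order all_algebra finmap zify.
From mathcomp Require Import boolp reals.
Set Implicit Arguments.
Unset Strict Implicit.
Unset Printing Implicit Defensive.
Import Order.TTheory GRing.Theory Num.Theory.

Fixpoint fib (n : nat) : nat :=
  match n with
  | 0 => 0
  | 1 => 1
  | (n'.+1 as m).+1 => fib m + fib n'
  end.

Arguments fib : simpl never.

Definition u (i : nat) : nat := fib (2 * i).

(* Digits are indexed from 1: the unused value d 0 is normalised to 0, which
   makes a representation unique as a function. *)
Definition admissible (d : nat -> nat) : Prop :=
  [/\ d 0 = 0,
      forall i, d i <= 2 &
      forall i j, i < j -> d i = 2 -> d j = 2 -> exists2 l, i < l < j & d l = 0].

Definition represents (d : {fsfun nat -> nat with 0}) (N : nat) : Prop :=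
  admissible d /\ N = \sum_(i <- finsupp d) d i * u i.

Lemma fibSS n : fib n.+2 = fib n.+1 + fib n.
Proof. by []. Qed.

Lemma uS n : u n.+1 = fib (2 * n).+1 + u n.
Proof. by rewrite /u (_ : 2 * n.+1 = (2 * n).+2); [|lia]. Qed.

Lemma fib_oddS n : fib (2 * n.+1).+1 = u n.+1 + fib (2 * n).+1.
Proof. by rewrite /u (_ : 2 * n.+1 = (2 * n).+2); [|lia]. Qed.

Lemma fib_odd_gt n : u n < fib (2 * n).+1.
Proof.
elim: n => // n IH; have := fib_oddS n; have := uS n; lia.
Qed.

Lemma fib_odd_le n : fib (2 * n).+1 <= u n.+1.
Proof. by rewrite uS leq_addr. Qed.

Lemma u_ge n : n <= u n.
Proof. by elim: n => // n IH; have := uS n; have := fib_odd_gt n; lia. Qed.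

(* A 2 may be put in position n.+1 above the digits d 0, ..., d n. *)
Definition open2 (d : nat -> nat) n : Prop :=
  forall i, i <= n -> d i = 2 -> exists2 l, i < l <= n & d l = 0.

Lemma partial_sum_lt d n : admissible d ->
  \sum_(i < n.+1) d i * u i < u n.+1 /\
  (open2 d n -> \sum_(i < n.+1) d i * u i < fib (2 * n).+1).
Proof.
move=> [d0 d2 dsep]; elim: n => [|n [IHA IHB]].
  by rewrite big_ord_recr big_ord0 /= d0.
have hu := uS n; have hu' := uS n.+1; have hf := fib_oddS n.
have hlt := fib_odd_gt n; have hlt' := fib_odd_gt n.+1.
have hd := d2 n.+1; rewrite big_ord_recr /=.
set s := (\sum_(i < n.+1) _) in IHA IHB *.
split=> [|op].
  have [e|ne] := eqVneq (d n.+1) 2; last nia.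
  suff /IHB : open2 d n by rewrite e; lia.
  by move=> i le_in di; have [] := dsep i n.+1 _ di e; [lia|move=> l; exists l].
have [e|ne] := eqVneq (d n.+1) 2.
  by have [l] := op n.+1 (leqnn _) e; lia.
have [e|ne0] := eqVneq (d n.+1) 0; first by rewrite e; lia.
have -> : d n.+1 = 1 by lia.
suff /IHB : open2 d n by lia.
move=> i le_in di; have [l /andP[il ln] dl] := op i (leqW le_in) di.
exists l => //; rewrite il /=.
by move: ln; rewrite leq_eqVlt => /orP[/eqP ll|//]; rewrite -ll dl in ne0.
Qed.

Lemma partial_sum_inj d e n : admissible d -> admissible e ->
  \sum_(i < n) d i * u i = \sum_(i < n) e i * u i ->
  forall i, i < n -> d i = e i.
Proof.
move=> ad ae; elim: n => // n IH.
rewrite !big_ord_recr /=; case: n IH => [|n] IH h i.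
  by case: ad ae => d0 _ _ [e0 _ _]; case: i => //; rewrite d0 e0.
have [hd _] := partial_sum_lt n ad; have [he _] := partial_sum_lt n ae.
have edn : d n.+1 = e n.+1.
  move: h hd he; move: (\sum_(i < n.+1) d _ * _) (\sum_(i < n.+1) e _ * _).
  by move=> s t; nia.
rewrite ltnS leq_eqVlt => /orP[/eqP->//|]; apply: IH.
by move: h; rewrite edn => /addIn.
Qed.

Lemma bounded_representation n N :
  (N < u n.+1 -> exists d, [/\ admissible d, forall i, n < i -> d i = 0 &
     N = \sum_(i < n.+1) d i * u i]) /\
  (N < fib (2 * n).+1 -> exists d, [/\ admissible d, forall i, n < i -> d i = 0,
     open2 d n & N = \sum_(i < n.+1) d i * u i]).
Proof.
elim: n N => [|n IH] N.
  have ad0 : admissible (fun=> 0) by split.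
  by split=> N0; exists (fun=> 0); rewrite big_ord_recr big_ord0 /=;
    case: N N0 => // N0; split.
have hu := uS n; have hu' := uS n.+1; have hf := fib_oddS n.
have hlt := fib_odd_gt n; have hlt' := fib_odd_gt n.+1.
pose ext (c : nat) (d : nat -> nat) i := if i == n.+1 then c else d i.
have ext_lo c d i : i <= n -> ext c d i = d i by rewrite /ext; case: eqP => //; lia.
have ext_top c d : ext c d n.+1 = c by rewrite /ext eqxx.
have ext_hi c d : (forall i, n < i -> d i = 0) ->
    forall i, n.+1 < i -> ext c d i = 0.
  by move=> d0 i lt_ni; rewrite /ext; case: eqP => [|_]; [|apply: d0]; lia.
have ext_sum c d : \sum_(i < n.+2) ext c d i * u i =
    \sum_(i < n.+1) d i * u i + c * u n.+1.
  rewrite big_ord_recr /= ext_top; congr (_ + _).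
  by apply: eq_bigr => i _; rewrite ext_lo // -ltnS.
have ext_adm c d : admissible d -> (forall i, n < i -> d i = 0) -> c <= 2 ->
    (c = 2 -> open2 d n) -> admissible (ext c d).
  move=> [d0 d2 dsep] dhi c2 op; split=> [|i|i j ij]; first by rewrite ext_lo.
    by rewrite /ext; case: eqP.
  have [jn|nj] := leqP j n.
    rewrite !ext_lo //; last by lia.
    move=> di dj; have [l lb dl] := dsep i j ij di dj.
    by exists l => //; rewrite ext_lo //; lia.
  have [jn|jn] := eqVneq j n.+1; last by rewrite (ext_hi c d dhi j) //; lia.
  have le_in : i <= n by lia.
  rewrite jn ext_lo // ext_top => di ce; have [l lb dl] := op ce i le_in di.
  by exists l; [lia|rewrite ext_lo //; lia].
have ext_open1 d : open2 d n -> open2 (ext 1 d) n.+1.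
  move=> op i; have [le_in _|lt_ni le_in] := leqP i n; last first.
    by rewrite (_ : i = n.+1); [rewrite ext_top|lia].
  rewrite ext_lo // => di; have [l lb dl] := op i le_in di.
  by exists l; [lia|rewrite ext_lo //; lia].
have ext_open0 d : open2 (ext 0 d) n.+1.
  move=> i; have [le_in _ _|lt_ni le_in] := leqP i n; last first.
    by rewrite (_ : i = n.+1); [rewrite ext_top|lia].
  by exists n.+1; [lia|].
split=> hN; have [Nlt|Nge] := ltnP N (u n.+1).
- have [/(_ Nlt) [d [ad dhi ->]] _] := IH N.
  exists (ext 0 d); split; [exact: ext_adm|exact: ext_hi|by rewrite ext_sum addn0].
- have [Nlt2|Nge2] := ltnP N (2 * u n.+1).
    have [+ _] := IH (N - u n.+1); case; first by lia.
    move=> d [ad dhi Nd]; exists (ext 1 d).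
    by split; [exact: ext_adm|exact: ext_hi|rewrite ext_sum -Nd; lia].
  have [_] := IH (N - 2 * u n.+1); case; first by lia.
  move=> d [ad dhi op Nd]; exists (ext 2 d).
  by split; [exact: ext_adm|exact: ext_hi|rewrite ext_sum -Nd; lia].
- have [/(_ Nlt) [d [ad dhi ->]] _] := IH N.
  by exists (ext 0 d); split; [exact: ext_adm|exact: ext_hi|exact: ext_open0|
    rewrite ext_sum addn0].
have [_] := IH (N - u n.+1); case; first by lia.
move=> d [ad dhi op Nd]; exists (ext 1 d).
by split; [exact: ext_adm|exact: ext_hi|exact: ext_open1|rewrite ext_sum -Nd; lia].
Qed.

Lemma sum_finsupp (d : {fsfun nat -> nat with 0}) n :
  (forall i, n <= i -> d i = 0) ->
  \sum_(i <- finsupp d) d i * u i = \sum_(i < n) d i * u i.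
Proof.
move=> dn; rewrite -(big_mkord predT (fun i => d i * u i)).
pose s : {fset nat} := [fset i in index_iota 0 n]%fset.
have sub : (finsupp d `<=` s)%fset.
  apply/fsubsetP => i; rewrite mem_finsupp !inE mem_index_iota /=.
  by case: ltnP => // /dn ->; rewrite eqxx.
rewrite (big_fset_incl _ sub) => [|i _]; last by rewrite memNfinsupp => /eqP ->.
apply: perm_big; apply: uniq_perm; [exact: fset_uniq|exact: iota_uniq|].
by move=> i; rewrite !inE.
Qed.

Lemma representation_exists (N : nat) : exists d, represents d N.
Proof.
have [+ _] := bounded_representation N N; case; first exact: u_ge.
move=> d [ad dhi Nd].
pose s : {fset nat} := [fset i in iota 0 N.+1]%fset.
pose e : {fsfun nat -> nat with 0} := [fsfun i in s => d i | 0].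
have ed i : e i = d i.
  rewrite /e fsfun_fun; case: ifPn => //; rewrite !inE mem_iota /= => Ni.
  by rewrite dhi //; lia.
exists e; split.
  have [d0 d2 dsep] := ad; split=> [|i|i j]; rewrite ?ed // => ij di dj.
  by have [l lb dl] := dsep i j ij di dj; exists l; rewrite ?ed.
rewrite (@sum_finsupp e N.+1) => [|i lt_Ni]; last by rewrite ed dhi.
by rewrite [LHS]Nd; apply: eq_bigr => i _; rewrite ed.
Qed.

Lemma representation_unique (N : nat) (d e : {fsfun nat -> nat with 0}) :
  represents d N -> represents e N -> d = e.
Proof.
move=> [ad Nd] [ae Ne]; apply/fsfunP => i.
have bnd (g : {fsfun nat -> nat with 0}) : exists n, forall j, n <= j -> g j = 0.
  exists (\max_(j <- finsupp g) j).+1 => j lt_j; apply/eqP.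
  rewrite -memNfinsupp; apply/negP => jg.
  by have := @leq_bigmax_seq nat (enum_fset (finsupp g)) predT id j jg isT; rewrite leqNgt lt_j.
have [[n dn] [m em]] := (bnd d, bnd e).
pose k := maxn i.+1 (maxn n m).
apply: (@partial_sum_inj d e k) => //; last by rewrite /k; lia.
rewrite -!sum_finsupp -?Nd //.
  by move=> j kj; apply: em; move: kj; rewrite /k; lia.
by move=> j kj; apply: dn; move: kj; rewrite /k; lia.
Qed.

Definition digits (N : nat) : {fsfun nat -> nat with 0} :=
  projT1 (cid (representation_exists N)).

Lemma digitsP (N : nat) : represents (digits N) N.
Proof. exact: projT2 (cid (representation_exists N)). Qed.

Local Open Scope ring_scope.

Definition f (R : realType) (a : nat) : R :=
  \sum_(i <- finsupp (digits a)) (digits a i)%:R / (u i)%:R.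

Lemma f_ge0 (R : realType) (a : nat) : 0 <= f R a.
Proof. by apply: sumr_ge0 => i _; rewrite divr_ge0. Qed.

(* Main.v *)
Require Import Defs.
From mathcomp Require Import all_boot all_order all_algebra.
From mathcomp Require Import reals.
From mathcomp Require Import boolp finmap zify ring lra.
Import Order.TTheory GRing.Theory Num.Theory.
Local Open Scope ring_scope.

(* Let e i be the difference of the i-th digits of b and a, D = b - a = sum e i * u i
   and G = f b - f a = sum e i / u i. Put L j = sum_(i < j) e i * u (j - i) and
   H j = sum_(i > j) e i * u (i - j). Reversals and shifts of admissible digit
   sequences are admissible, and admissible sequences compare lexicographically,
   so L has the sign of the lowest nonzero e i and H the sign of the highest one.
   The difference p = H - L satisfies p (j + 2) = 3 p (j + 1) - p j and
   D = p k * u (k + 1) - p (k + 1) * u k. Summation by parts and the convexity of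
   1 / u give G >= p k / u (k + 1) - p (k + 1) / u k when L, H >= 0, and for k at
   or above the top digit this only needs L >= 0.
   If both extreme signs are positive, choose k with p k >= 0 > p (k + 1): then D
   and G are positive combinations of u k, u (k + 1) and of their inverses.
   If the signs are opposite, p has constant sign on all integers, which makes the
   invariant p (k + 1) ^ 2 - 3 p k p (k + 1) + p k ^ 2 (the norm of
   sum e i phi ^ (2 i) in Z[phi], phi the golden ratio) a negative integer, and
   - D * G >= - norm + p k p (k + 1) / (u k u (k + 1)) >= 1. *)

(** * Recurrence and quadratic identity for [u] *)

Lemma u_rec n : (u n.+2 + u n = 3 * u n.+1)%N.
Proof. by have := uS n; have := uS n.+1; have := fib_oddS n; lia. Qed.

(** Truncated subtraction preserves the recurrence except where it starts, at [i = j + 1]: there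
    [u 1 = 1] appears on the left against [u 0 = 0] on the right. *)
Lemma u_subn_rec i j :
  (u (j.+2 - i) + u (j - i) = 3 * u (j.+1 - i) + (i == j.+1))%N.
Proof.
case: (ltngtP i j.+1) => [lt_ij|lt_ji|->].
- by rewrite !subSn ?u_rec ?addn0 // ltnW.
- have /eqP -> : (j.+2 - i == 0)%N by lia.
  have /eqP -> : (j - i == 0)%N by lia.
  by have /eqP -> : (j.+1 - i == 0)%N by lia.
- rewrite subSnn subnn.
  by have /eqP -> : (j - j.+1 == 0)%N by lia.
Qed.

Lemma u_addn_rec i j :
  (u (i - j.+2) + u (i - j) = 3 * u (i - j.+1) + (i == j.+1))%N.
Proof.
case: (ltngtP i j.+1) => [lt_ij|lt_ji|->].
- have /eqP -> : (i - j.+2 == 0)%N by lia.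
  have /eqP -> : (i - j == 0)%N by lia.
  by have /eqP -> : (i - j.+1 == 0)%N by lia.
- have /eqP -> : (i - j == (i - j.+2).+2)%N by lia.
  have /eqP -> : (i - j.+1 == (i - j.+2).+1)%N by lia.
  by rewrite addnC u_rec addn0.
- rewrite subSnn subnn.
  by have /eqP -> : (j.+1 - j.+2 == 0)%N by lia.
Qed.

Lemma u_gt0 n : (0 < u n.+1)%N.
Proof. by have := u_ge n.+1; lia. Qed.

(** The form [x^2 - 3xy + y^2] is invariant under the recurrence and equals 1 at [(u 0, u 1)]. *)
Lemma u_norm n : (u n.+1 ^ 2 + u n ^ 2 = 3 * (u n * u n.+1) + 1)%N.
Proof. by elim: n => // n IH; have := u_rec n; nia. Qed.

(** * Order and symmetries of admissible sequences *)

(** By [partial_sum_lt] the digits of [d] below [n] contribute less than [u n], so one extra unit at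
    [n] outweighs them. *)
Lemma lex_sum_lt d e n K : admissible d -> admissible e ->
    (forall i, (n < i)%N -> d i = e i) -> (d n < e n)%N -> (n < K)%N ->
  (\sum_(i < K) d i * u i < \sum_(i < K) e i * u i)%N.
Proof.
move=> ad ae de dn; elim: K => // K IH; rewrite ltnS leq_eqVlt !big_ord_recr /=.
case/orP=> [/eqP <-|nK]; last by rewrite (de _ nK) ltn_add2r IH.
case: n {K IH de} dn => [|n] dn; first by case: ad dn => -> _ _; case: ae => ->.
have [hd _] := partial_sum_lt n ad.
by move: hd dn; move: (\sum_(i < n.+1) d _ * _)%N (\sum_(i < n.+1) e _ * _)%N; nia.
Qed.

(** These turn sums against [u (j - i)], [u (i - j)] and [u (i + j)] into ordinary digit sums. The
    guards discard values produced by truncated subtraction and keep position 0 at 0. *)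
Definition reverse (d : nat -> nat) j i := if (0 < i <= j)%N then d (j - i)%N else 0%N.
Definition shift_down (d : nat -> nat) j i := if (0 < i)%N then d (i + j)%N else 0%N.
Definition shift_up (d : nat -> nat) j i := if (j <= i)%N then d (i - j)%N else 0%N.

Lemma reverse_admissible d j : admissible d -> admissible (reverse d j).
Proof.
move=> [d0 d2 dsep]; split=> // [i|i i']; rewrite /reverse; first by case: ifP.
move=> ii'; case: ifP => // hi di; case: ifP => // hi' di'.
have [|l hl dl] := dsep (j - i')%N (j - i)%N _ di' di; first by lia.
exists (j - l)%N; first by lia.
by rewrite (_ : (0 < j - l <= j)%N) ?subKn //; lia.
Qed.

Lemma shift_down_admissible d j : admissible d -> admissible (shift_down d j).
Proof.
move=> [d0 d2 dsep]; split=> // [i|i i']; rewrite /shift_down; first by case: ifP.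
move=> ii'; case: ifP => // hi di; case: ifP => // hi' di'.
have [|l hl dl] := dsep (i + j)%N (i' + j)%N _ di di'; first by lia.
exists (l - j)%N; first by lia.
by rewrite (_ : (0 < l - j)%N) ?subnK //; lia.
Qed.

Lemma shift_up_admissible d j : admissible d -> admissible (shift_up d j).
Proof.
move=> [d0 d2 dsep]; split=> // [|i|i i']; rewrite /shift_up ?sub0n; try by case: ifP.
move=> ii'; case: ifP => // hi di; case: ifP => // hi' di'.
have [|l hl dl] := dsep (i - j)%N (i' - j)%N _ di di'; first by lia.
exists (l + j)%N; first by lia.
by rewrite leq_addl addnK.
Qed.

Section Sums.
Variables (d : nat -> nat) (K : nat).
Hypothesis dK : forall i, (K <= i)%N -> d i = 0%N.

Lemma sum_extend (F : nat -> nat) n :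
  (\sum_(i < K) d i * F i = \sum_(i < K + n) d i * F i)%N.
Proof.
rewrite big_split_ord /= [X in (_ + X)%N]big1 ?addn0 // => i _.
by rewrite dK ?leq_addr.
Qed.

Lemma sum_reverse j : d 0%N = 0%N ->
  (\sum_(i < K) d i * u (j - i) = \sum_(i < j.+1) reverse d j i * u i)%N.
Proof.
(* The longer range [K + j + 1] can be split at [j + 1] whatever the size of [K]; past the split
   [u (j - i)] is [u 0 = 0]. *)
move=> d0; rewrite (sum_extend (fun i => u (j - i)) j.+1) addnC big_split_ord /=.
rewrite [X in (_ + X)%N]big1 ?addn0 => [|i _]; last first.
  by rewrite (_ : j - _ = 0)%N ?muln0; lia.
rewrite (reindex_inj rev_ord_inj) /=; apply: eq_bigr => i _.
rewrite subSS subKn /reverse; last by rewrite -ltnS.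
by have := ltn_ord i; case: ifP => //; case: (nat_of_ord i) => [|i']; rewrite ?muln0 //; lia.
Qed.

Lemma sum_shift_down j :
  (\sum_(i < K) d i * u (i - j) = \sum_(i < K) shift_down d j i * u i)%N.
Proof.
rewrite (sum_extend (fun i => u (i - j)) j) addnC big_split_ord /=.
rewrite [X in (X + _)%N]big1 ?add0n => [|i _]; last first.
  by rewrite (_ : _ - j = 0)%N ?muln0 //; have := ltn_ord i; lia.
apply: eq_bigr => i _; rewrite addnC addnK /shift_down.
by case: (nat_of_ord i) => [|i'] //; rewrite muln0.
Qed.

Lemma sum_shift_up j :
  (\sum_(i < K) d i * u (i + j) = \sum_(i < j + K) shift_up d j i * u i)%N.
Proof.
rewrite big_split_ord /= [X in (X + _)%N]big1 ?add0n => [|i _]; last first.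
  by rewrite /shift_up leqNgt ltn_ord.
by apply: eq_bigr => i _; rewrite /shift_up leq_addr addKn [(j + i)%N]addnC.
Qed.

End Sums.

(* Since u 0 = 0, truncated subtraction restricts low_sum to i < j and high_sum
   to i > j. *)
Definition low_sum (R : comNzRingType) K (e : nat -> R) j : R :=
  \sum_(i < K) e i * (u (j - i))%:R.
Definition high_sum (R : comNzRingType) K (e : nat -> R) j : R :=
  \sum_(i < K) e i * (u (i - j))%:R.
Definition gap (R : comNzRingType) K (e : nat -> R) j : R :=
  high_sum R K e j - low_sum R K e j.

(** * Recurrences and invariants of [gap] *)

Section Recurrences.
Variables (R : comNzRingType) (K : nat) (e : nat -> R).

Lemma sum_delta j : \sum_(i < K) e i * (nat_of_ord i == j)%:R = if (j < K)%N then e j else 0.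
Proof.
case: ifP => jK; last first.
  rewrite big1 // => i _; case: eqP => [ij|_]; last by rewrite mulr0.
  by rewrite -ij ltn_ord in jK.
rewrite (bigD1 (Ordinal jK)) //= eqxx mulr1 big1 ?addr0 // => i.
by rewrite -val_eqE /= => /negbTE ->; rewrite mulr0.
Qed.

Lemma low_sum_rec j : low_sum R K e j.+2 + low_sum R K e j =
  3 * low_sum R K e j.+1 + (if (j.+1 < K)%N then e j.+1 else 0).
Proof.
rewrite -sum_delta /low_sum mulr_sumr -!big_split; apply: eq_bigr => i _ /=.
by rewrite -mulrDr -natrD u_subn_rec natrD natrM; ring.
Qed.

Lemma high_sum_rec j : high_sum R K e j.+2 + high_sum R K e j =
  3 * high_sum R K e j.+1 + (if (j.+1 < K)%N then e j.+1 else 0).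
Proof.
rewrite -sum_delta /high_sum mulr_sumr -!big_split; apply: eq_bigr => i _ /=.
by rewrite -mulrDr -natrD u_addn_rec natrD natrM; ring.
Qed.

(** The source terms in the recurrences of the low and high sums coincide and cancel. *)
Lemma gap_rec j : gap R K e j.+2 = 3 * gap R K e j.+1 - gap R K e j.
Proof.
rewrite /gap (canRL (addrK _) (low_sum_rec j)).
by rewrite (canRL (addrK _) (high_sum_rec j)); ring.
Qed.

Lemma low_sum0 : low_sum R K e 0 = 0.
Proof. by rewrite /low_sum big1 // => i _; rewrite sub0n mulr0. Qed.

Lemma low_sum1 : e 0%N = 0 -> low_sum R K e 1 = 0.
Proof.
move=> e0; rewrite /low_sum big1 // => [[[|i] hi] _] /=; first by rewrite e0 mul0r.
by rewrite subSS sub0n mulr0.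
Qed.

Lemma gap0 : gap R K e 0 = \sum_(i < K) e i * (u i)%:R.
Proof.
by rewrite /gap low_sum0 subr0; apply: eq_bigr => i _; rewrite subn0.
Qed.

(** The Casoratian of two solutions of the same recurrence is constant here; at [k = 0] it is read
    off from [u 0 = 0] and [u 1 = 1]. *)
Lemma gap_wronskian k :
  gap R K e k * (u k.+1)%:R - gap R K e k.+1 * (u k)%:R = gap R K e 0.
Proof.
elim: k => [|k <-]; first by rewrite mulr1 mulr0 subr0.
have h : (u k.+2)%:R = 3 * (u k.+1)%:R - (u k)%:R :> R.
  by apply/(canRL (addrK _)); rewrite -natrD u_rec natrM.
by rewrite gap_rec h; ring.
Qed.

Definition gap_norm k :=
  gap R K e k.+1 ^+ 2 - 3 * gap R K e k * gap R K e k.+1 + gap R K e k ^+ 2.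

Lemma gap_normE k : gap_norm k = gap_norm 0.
Proof. by elim: k => // k <-; rewrite /gap_norm gap_rec; ring. Qed.

End Recurrences.

(** Signs are settled over the integers, where negative means at most -1, while the inverses of [u]
    live in a field; the casts link the two. *)
Lemma low_sum_intr (R : comNzRingType) K (e : nat -> int) j :
  low_sum R K (fun i => (e i)%:~R) j = (low_sum int K e j)%:~R.
Proof. by rewrite rmorph_sum; apply: eq_bigr => i _ /=; rewrite intrM natz -pmulrn. Qed.

Lemma high_sum_intr (R : comNzRingType) K (e : nat -> int) j :
  high_sum R K (fun i => (e i)%:~R) j = (high_sum int K e j)%:~R.
Proof. by rewrite rmorph_sum; apply: eq_bigr => i _ /=; rewrite intrM natz -pmulrn. Qed.

Lemma gap_intr (R : comNzRingType) K (e : nat -> int) j :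
  gap R K (fun i => (e i)%:~R) j = (gap int K e j)%:~R.
Proof. by rewrite /gap low_sum_intr high_sum_intr rmorphB. Qed.

(** * Convexity of [1 / u] and summation by parts *)

Section Inequalities.
Variables (F : realFieldType) (K : nat) (e : nat -> F).

Local Notation w i := ((u i)%:R^-1).

(** For consecutive values [x, y, z] the claim is [(x + z) y >= 3 x z], which follows from
    [x + z = 3 y] and [x z = y^2 - 1]. *)
Lemma u_inv_convex j : 3 * w j.+2 <= w j.+1 + w j.+3 :> F.
Proof.
have := u_rec j.+1; have := u_norm j.+1.
have := u_gt0 j; have := u_gt0 j.+1; have := u_gt0 j.+2.
move: (u j.+1) (u j.+2) (u j.+3) => x y z z0 y0 x0 n r.
have x0' : 0 < x%:R :> F by rewrite ltr0n.
have y0' : 0 < y%:R :> F by rewrite ltr0n.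
have z0' : 0 < z%:R :> F by rewrite ltr0n.
rewrite -subr_ge0.
have -> : x%:R^-1 + z%:R^-1 - 3 * y%:R^-1 =
    ((x + z)%:R * y%:R - 3 * (x%:R * z%:R)) / (x%:R * y%:R * z%:R) :> F.
  by rewrite natrD; field; rewrite !gt_eqF.
apply: divr_ge0; last by rewrite !mulr_ge0 // ltW.
by rewrite -!natrM subr_ge0 ler_nat; nia.
Qed.

Hypothesis e0 : e 0%N = 0.

(** From [k] to [k + 1] the left side grows by [e (k+2) w (k+2)] minus the nonnegative product of
    [low_sum] at [k + 2] and the convexity defect of [w]. *)
Lemma low_sum_bound k : (forall j, 0 <= low_sum F K e j) -> (k.+1 < K)%N ->
  low_sum F K e k.+2 * w k.+1 - low_sum F K e k.+1 * w k.+2 <=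
    \sum_(i < k.+2) e i * w i.
Proof.
move=> L0; elim: k => [|k IH] kK; have := low_sum_rec F K e.
  move/(_ 0%N); rewrite kK low_sum0 low_sum1 // mulr0 add0r addr0 => ->.
  by rewrite mul0r subr0 !big_ord_recr big_ord0 /= e0 mul0r !add0r.
move/(_ k.+1); rewrite kK => /esym/(canRL (addKr _)) h.
rewrite big_ord_recr /= h; have := IH (ltnW kK).
have := mulr_ge0 (L0 k.+2) (_ : 0 <= w k.+1 + w k.+3 - 3 * w k.+2).
rewrite subr_ge0 => /(_ (u_inv_convex k)).
lra.
Qed.

Lemma high_sum_bound k : (forall j, 0 <= high_sum F K e j) -> (k.+1 < K)%N ->
  high_sum F K e k.+1 * w k.+2 - high_sum F K e k.+2 * w k.+1 <=
    \sum_(k.+2 <= i < K) e i * w i.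
Proof.
(* Induction on the number [t] of terms, from the top down; for [t = 0] both high sums vanish. *)
move=> H0 kK; have [t Kt] : exists t, K = (k.+2 + t)%N by exists (K - k.+2)%N; lia.
elim: t k kK Kt => [|t IH] k kK Kt.
  have hz j : (k < j)%N -> high_sum F K e j = 0.
    move=> kj; rewrite /high_sum big1 // => i _.
    by have /eqP -> : (i - j == 0)%N; [have := ltn_ord i; lia|rewrite mulr0].
  by rewrite !hz // !mul0r subr0 big_geq // Kt addn0.
have kK' : (k.+2 < K)%N by lia.
have := high_sum_rec F K e k.+1; rewrite kK' => /esym/(canRL (addKr _)) h.
rewrite big_ltn // h; have := IH k.+1 kK' ltac:(lia).
have := mulr_ge0 (H0 k.+2) (_ : 0 <= w k.+1 + w k.+3 - 3 * w k.+2).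
rewrite subr_ge0 => /(_ (u_inv_convex k)).
lra.
Qed.

End Inequalities.

(** * Infinite descent for the norm form *)

(** The form is invariant under shifts, and a positive integer sequence cannot decrease forever, so
    it suffices to check the sign where the decrease stops. *)
Lemma descent_norm_lt0 (q : nat -> int) :
    (forall j, q j.+2 = 3 * q j.+1 - q j) -> (forall j, 0 < q j) -> q 1%N <= q 0%N ->
  q 1%N ^+ 2 - 3 * q 0%N * q 1%N + q 0%N ^+ 2 < 0.
Proof.
have [n] := ubnP `|q 0%N|%N; elim: n q => // n IH q lt_n rec pos.
rewrite le_eqVlt => /orP[/eqP ->|lt10].
  by have := pos 0%N; nra.
have [le21|lt12] := leP (q 2%N) (q 1%N).
  have := IH (fun j => q j.+1) _ (fun j => rec j.+1) (fun j => pos j.+1) le21.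
  rewrite (rec 0%N) => /(_ ltac:(have := pos 1%N; lia)).
  by apply: le_lt_trans; rewrite le_eqVlt; apply/orP; left; apply/eqP; ring.
(* Here [q 1 < q 0 < 2 q 1], and the form is [(q 0 - q 1)(q 0 - 2 q 1) - (q 1)^2]. *)
by have := pos 0%N; have := pos 1%N; move: lt12; rewrite (rec 0%N); nia.
Qed.

(** * Signs of the low, high and shifted sums *)

Section DigitComparison.
Variables (K : nat) (d e : nat -> nat).
Hypotheses (ad : admissible d) (ae : admissible e).
Hypotheses (dK : forall i, (K <= i)%N -> d i = 0%N).
Hypotheses (eK : forall i, (K <= i)%N -> e i = 0%N).

(** Reversal about [j] moves the lowest difference [m] to the highest position [j - m], where
    lexicographic comparison decides. *)
Lemma low_digits_lt m j : (forall i, (i < m)%N -> d i = e i) -> (d m < e m)%N ->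
    (m < j)%N ->
  (\sum_(i < K) d i * u (j - i) < \sum_(i < K) e i * u (j - i))%N.
Proof.
move=> de dm mj; have [[d0 _ _] [e0 _ _]] := (ad, ae).
rewrite !sum_reverse //; apply: (@lex_sum_lt _ _ (j - m)%N); last by lia.
- exact: reverse_admissible.
- exact: reverse_admissible.
- by move=> i hi; rewrite /reverse; case: ifP => // hij; apply: de; lia.
- by rewrite /reverse (_ : (0 < j - m <= j)%N) ?subKn //; lia.
Qed.

Lemma low_digits_le m j : (forall i, (i < m)%N -> d i = e i) -> (d m < e m)%N ->
  (\sum_(i < K) d i * u (j - i) <= \sum_(i < K) e i * u (j - i))%N.
Proof.
move=> de dm; have [jm|mj] := leqP j m; last by apply/ltnW/(@low_digits_lt m).
apply: leq_sum => i _; have [im|mi] := ltnP i m; first by rewrite de.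
by have /eqP -> : (j - i == 0)%N by [lia]; rewrite !muln0.
Qed.

Lemma high_digits_lt n j : (forall i, (n < i)%N -> d i = e i) -> (d n < e n)%N ->
    (j < n)%N ->
  (\sum_(i < K) d i * u (i - j) < \sum_(i < K) e i * u (i - j))%N.
Proof.
move=> de dn jn; have nK : (n < K)%N by case: leqP => // /eK en; lia.
rewrite !sum_shift_down //; apply: (@lex_sum_lt _ _ (n - j)%N); last by lia.
- exact: shift_down_admissible.
- exact: shift_down_admissible.
- by move=> i hi; rewrite /shift_down; case: ifP => // _; apply: de; lia.
- by rewrite /shift_down subn_gt0 jn subnK // ltnW.
Qed.

Lemma high_digits_le n j : (forall i, (n < i)%N -> d i = e i) -> (d n < e n)%N ->
  (\sum_(i < K) d i * u (i - j) <= \sum_(i < K) e i * u (i - j))%N.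
Proof.
move=> de dn; have [nj|jn] := leqP n j; last by apply/ltnW/(@high_digits_lt n).
apply: leq_sum => i _; have [ni|li] := ltnP n i; first by rewrite de.
by have /eqP -> : (i - j == 0)%N by [lia]; rewrite !muln0.
Qed.

Lemma shifted_digits_lt n j : (forall i, (n < i)%N -> d i = e i) -> (d n < e n)%N ->
  (\sum_(i < K) d i * u (i + j) < \sum_(i < K) e i * u (i + j))%N.
Proof.
move=> de dn; have nK : (n < K)%N by case: leqP => // /eK en; lia.
rewrite !sum_shift_up //; apply: (@lex_sum_lt _ _ (n + j)%N); last by lia.
- exact: shift_up_admissible.
- exact: shift_up_admissible.
- by move=> i hi; rewrite /shift_up; case: ifP => // _; apply: de; lia.
- by rewrite /shift_up leq_addl addnK.
Qed.

End DigitComparison.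

(** * Negative indices and the sign of the norm *)

Lemma sum_digits_sub K (a b w : nat -> nat) :
  \sum_(i < K) ((b i)%:Z - (a i)%:Z) * (w i)%:R =
  (\sum_(i < K) b i * w i)%N%:Z - (\sum_(i < K) a i * w i)%N%:Z.
Proof.
rewrite -!natz !natr_sum -sumrB; apply: eq_bigr => i _.
by rewrite -!natz !natrM mulrBl.
Qed.

(* The sums over u (i + j) extend gap to the negative indices - j. *)
Lemma gap_backward K (e : nat -> int) :
  \sum_(i < K) e i * (u (i + 1))%:R = 3 * gap int K e 0 - gap int K e 1.
Proof.
rewrite gap0 /gap /high_sum /low_sum opprB mulr_sumr -sumrB -big_split /=.
apply: eq_bigr => i _; case: (nat_of_ord i) => [|j].
  by rewrite !sub0n subn0 (_ : u 0 = 0%N) //; ring.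
rewrite addn1 subSS sub0n subn1 (_ : u 0 = 0%N) //=.
have -> : (u j.+2)%:R = 3 * (u j.+1)%:R - (u j)%:R :> int.
  by apply/(canRL (addrK _)); rewrite -natrD u_rec natrM.
by ring.
Qed.

Lemma shifted_sum_rec K (e : nat -> int) j :
  \sum_(i < K) e i * (u (i + j.+2))%:R =
  3 * \sum_(i < K) e i * (u (i + j.+1))%:R - \sum_(i < K) e i * (u (i + j))%:R.
Proof.
rewrite mulr_sumr -sumrB; apply: eq_bigr => i _.
have -> : (u (i + j.+2))%:R = 3 * (u (i + j.+1))%:R - (u (i + j))%:R :> int.
  by apply/(canRL (addrK _)); rewrite -natrD !addnS u_rec natrM.
by ring.
Qed.

(** The negated two-sided sequence is positive. Descent runs to the right from the indices 0, 1, or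
    to the left from 1, 0, whichever starts without an increase; the form is symmetric in its
    arguments. *)
Lemma gap_norm_lt0 K (e : nat -> int) :
    (forall j, gap int K e j < 0) ->
    (forall j, \sum_(i < K) e i * (u (i + j))%:R < 0) ->
  gap_norm int K e 0 < 0.
Proof.
move=> p0 q0; rewrite /gap_norm.
have [le01|lt10] := leP (gap int K e 0) (gap int K e 1).
  have := @descent_norm_lt0 (fun j => - gap int K e j).
  rewrite !sqrrN !mulrN mulNr opprK lerN2; apply=> // j; last by rewrite oppr_gt0.
  by rewrite gap_rec; ring.
pose q j := - if j is j'.+1 then \sum_(i < K) e i * (u (i + j'))%:R else gap int K e 1.
have q1 : q 1%N = - gap int K e 0.
  by rewrite gap0; congr (- _); apply: eq_bigr => i _; rewrite addn0.
(* Here gap is descended along 1, 0, -1, -2, ... *)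
have := @descent_norm_lt0 q; rewrite q1 /= !sqrrN !mulrN mulNr opprK lerN2.
have -> x y : x ^+ 2 - 3 * y * x + y ^+ 2 = y ^+ 2 - 3 * x * y + x ^+ 2 :> int by ring.
apply=> [[|j]|[|j]|]; rewrite ?q1 ?oppr_gt0 //; last exact: ltW.
  by rewrite /q gap_backward; ring.
by rewrite /q shifted_sum_rec; ring.
Qed.

(** * The two estimates for [D] and [G] *)

Section Estimate.
Variables (F : realFieldType) (K : nat) (e : nat -> int).
Hypothesis e0 : e 0%N = 0.
Hypothesis L0 : forall j, 0 <= low_sum int K e j.

Let eF i : F := (e i)%:~R.
Let D : F := \sum_(i < K) eF i * (u i)%:R.
Let G : F := \sum_(i < K) eF i / (u i)%:R.

Let gapF j : gap F K eF j = (gap int K e j)%:~R.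
Proof. exact: gap_intr. Qed.

Let eF0 : eF 0%N = 0.
Proof. by rewrite /eF e0. Qed.

Let LF0 j : 0 <= low_sum F K eF j.
Proof. by rewrite low_sum_intr ler0z. Qed.

Let uF0 j : 0 < (u j.+1)%:R :> F.
Proof. by rewrite ltr0n u_gt0. Qed.

Let DE k : D = gap F K eF k * (u k.+1)%:R - gap F K eF k.+1 * (u k)%:R.
Proof. by rewrite gap_wronskian gap0. Qed.

Lemma same_sign_estimate :
  (forall j, 0 <= high_sum int K e j) -> 0 < low_sum int K e K -> 1 <= D * G.
Proof.
move=> H0 LK.
have HK : high_sum int K e K = 0.
  rewrite /high_sum big1 // => i _.
  by have /eqP -> : (i - K == 0)%N; [have := ltn_ord i; lia|rewrite mulr0].
have ex : exists k, gap int K e k < 0.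
  by exists K; rewrite /gap HK sub0r oppr_lt0.
(* At the first negative index [n], [gap] changes sign from [n - 1] to [n]; [n >= 2] because the low
   sums at 0 and 1 vanish. *)
case: (ex_minnP ex) => n pn nmin.
have nK : (n <= K)%N by apply: nmin; rewrite /gap HK sub0r oppr_lt0.
case: n pn nmin nK => [|[|k]] pn nmin nK.
- by move: pn; rewrite /gap low_sum0 subr0 ltNge H0.
- by move: pn; rewrite /gap low_sum1 // subr0 ltNge H0.
have {}nmin : 0 <= gap int K e k.+1.
  by rewrite leNgt; apply/negP => /nmin; rewrite ltnn.
have HF j : 0 <= high_sum F K eF j by rewrite high_sum_intr ler0z.
have lb := low_sum_bound F K eF eF0 k LF0 nK; have hb := high_sum_bound F K eF k HF nK.
have GE : G = \sum_(i < k.+2) eF i / (u i)%:R + \sum_(k.+2 <= i < K) eF i / (u i)%:R.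
  by rewrite /G -!(big_mkord predT (fun i => eF i / (u i)%:R)) -big_cat_nat.
have P1 : 0 <= gap F K eF k.+1 by rewrite gapF ler0z.
have P2 : gap F K eF k.+2 <= -1.
  by rewrite gapF (_ : -1 = (-1)%:~R) ?ler_int //; lia.
have lbG : gap F K eF k.+1 / (u k.+2)%:R - gap F K eF k.+2 / (u k.+1)%:R <= G.
  by rewrite GE /gap; lra.
have DEk := DE k.+1; have x0 := uF0 k; have y0 := uF0 k.+1.
move: P1 P2 lbG DEk x0 y0.
move: (gap F K eF k.+1) (gap F K eF k.+2) (u k.+1)%:R (u k.+2)%:R => p q x y.
move=> p0 q0 lbG Dk x0 y0.
(* With [p >= 0] and [q <= -1], [D = p y - q x] is at least [x], and [G >= p / y - q / x] is at
   least [1 / x]. *)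
have hD : x <= D by rewrite Dk; have := mulr_ge0 p0 (ltW y0); nra.
have hG : x^-1 <= G.
  apply: le_trans lbG; have := mulr_ge0 p0 (_ : 0 <= y^-1); rewrite invr_ge0 ltW // => /(_ isT).
  by have : 0 < x^-1 by [rewrite invr_gt0]; nra.
by rewrite -(divff (lt0r_neq0 x0)) ler_pM // ?invr_ge0 ltW.
Qed.

Lemma opposite_sign_estimate :
    (1 < K)%N -> (forall j, gap int K e j < 0) ->
    (forall j, \sum_(i < K) e i * (u (i + j))%:R < 0) ->
  1 <= - D * G.
Proof.
(* With [k = K - 2] the low bound covers all of [G], and the high sums at [k + 1] and [k + 2]
   vanish. *)
move=> K1 p0 q0; have [k Kk] : exists k, K = k.+2 by exists K.-2; lia.
have kK : (k.+1 < K)%N by rewrite Kk.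
have lb := low_sum_bound F K eF eF0 k LF0 kK;
have Hz j : (k < j)%N -> high_sum F K eF j = 0.
  move=> kj; rewrite /high_sum big1 // => i _.
  by have /eqP -> : (i - j == 0)%N; [have := ltn_ord i; lia|rewrite mulr0].
have N1 : gap_norm F K eF k.+1 <= -1.
  rewrite gap_normE /gap_norm !gapF; have := gap_norm_lt0 K e p0 q0; rewrite /gap_norm.
  move: (gap int K e 0) (gap int K e 1) => x y lt0.
  have -> : y%:~R ^+ 2 - 3 * x%:~R * y%:~R + x%:~R ^+ 2 =
     (y ^+ 2 - 3 * x * y + x ^+ 2)%:~R :> F.
    by rewrite rmorphD rmorphB !rmorphXn !rmorphM.
  by rewrite (_ : -1 = (-1)%:~R) ?ler_int //; lia.
have lbG : gap F K eF k.+1 / (u k.+2)%:R - gap F K eF k.+2 / (u k.+1)%:R <= G.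
  have -> : G = \sum_(i < k.+2) eF i / (u i)%:R by rewrite /G Kk.
  by move: lb; rewrite /gap !Hz //; lra.
have P1 : gap F K eF k.+1 < 0 by rewrite gapF ltrz0.
have P2 : gap F K eF k.+2 < 0 by rewrite gapF ltrz0.
have D0 : D < 0 by rewrite /D -gap0 gapF ltrz0.
have n2 : (u k.+2)%:R ^+ 2 + (u k.+1)%:R ^+ 2 = 3 * ((u k.+1)%:R * (u k.+2)%:R) + 1 :> F.
  by rewrite -!natrX -natrD u_norm natrD !natrM.
have DEk := DE k.+1; have x0 := uF0 k; have y0 := uF0 k.+1.
rewrite /gap_norm in N1; move: N1 P1 P2 n2 lbG DEk x0 y0.
move: (gap F K eF k.+1) (gap F K eF k.+2) (u k.+1)%:R (u k.+2)%:R => p q x y.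
move=> N1 p1 q1 n2 lbG Dk x0 y0.
have D0' : 0 <= - D by rewrite oppr_ge0 ltW.
apply: le_trans (ler_wpM2l D0' lbG).
(* Expanding [(p y - q x)(p / y - q / x)] leaves the cross term [p q (x^2 + y^2) / (x y)], where
   [x^2 + y^2 = 3 x y + 1]. *)
have -> : - D * (p / y - q / x) = - (q ^+ 2 - 3 * p * q + p ^+ 2) +
    p * q / (x * y).
  have -> : p * q / (x * y) = p * q * (y ^+ 2 + x ^+ 2 - 3 * (x * y)) / (x * y).
    by rewrite n2; congr (_ / _); ring.
  by rewrite Dk; field; rewrite !gt_eqF.
have : 0 < p * q / (x * y) by rewrite divr_gt0 ?(nmulr_rgt0 _ p1) ?mulr_gt0.
lra.
Qed.

End Estimate.

(** * Sign cases for two digit sequences *)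

(** The positive lowest difference makes all low sums nonnegative; the sign at the highest
    difference [n] selects one of the two estimates. *)
Lemma digit_estimate (F : realFieldType) K (d e : nat -> nat) m :
    admissible d -> admissible e ->
    (forall i, (K <= i)%N -> d i = 0%N) -> (forall i, (K <= i)%N -> e i = 0%N) ->
    (forall i, (i < m)%N -> d i = e i) -> (d m < e m)%N ->
  1 <= `|\sum_(i < K) ((e i)%:Z - (d i)%:Z)%:~R * (u i)%:R| *
       `|\sum_(i < K) ((e i)%:Z - (d i)%:Z)%:~R / (u i)%:R| :> F.
Proof.
move=> ad ae dK eK de dm; pose c i := (e i)%:Z - (d i)%:Z.
have c0 : c 0%N = 0 by case: ad ae => d0 _ _ [e0 _ _]; rewrite /c d0 e0.
have m0 : (0 < m)%N by case: m dm {de} => // dm; move: c0; rewrite /c; lia.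
have mK : (m < K)%N by case: leqP => // /eK em; rewrite em in dm.
have L0 j : 0 <= low_sum int K c j.
  rewrite /low_sum (sum_digits_sub K d e (fun i => u (j - i))) subr_ge0 lez_nat.
  exact: (low_digits_le K _ _ ad ae dK eK m).
have Lpos j : (m < j)%N -> 0 < low_sum int K c j.
  move=> mj; rewrite /low_sum (sum_digits_sub K d e (fun i => u (j - i))) subr_gt0.
  exact: (low_digits_lt K _ _ ad ae dK eK m).
have ex : exists i, d i != e i by exists m; rewrite neq_ltn dm.
have bnd i : d i != e i -> (i <= K)%N.
  by move=> ne; rewrite leqNgt; apply: contra ne => /ltnW Ki; rewrite dK ?eK.
have [n nen nmax] := ex_maxnP ex bnd.
have {}nmax i : (n < i)%N -> d i = e i.
  by move=> ni; apply/eqP; apply: contraTT ni => /nmax; rewrite leqNgt.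
rewrite -normrM; move: nen; rewrite neq_ltn => /orP[dn|en].
  apply: le_trans (ler_norm _); apply: (same_sign_estimate F K c) => //; last exact: Lpos.
  move=> j; rewrite /high_sum (sum_digits_sub K d e (fun i => u (i - j))).
  by rewrite subr_ge0 lez_nat; apply: (high_digits_le K _ _ ad ae dK eK n).
have nmax' i : (n < i)%N -> e i = d i by move=> /nmax.
have mn : (m < n)%N.
  case: (ltngtP m n) => // [nm|mn]; last by move: en dm; rewrite mn; lia.
  by move: dm; rewrite nmax // ltnn.
rewrite -normrN -mulNr; apply: le_trans (ler_norm _).
apply: (opposite_sign_estimate F K c) => // [|j|j]; first by lia.
- have HE : high_sum int K c j = _ := sum_digits_sub K d e (fun i => u (i - j)).
  (* Above [m] the low sum is strictly positive; at or below [m < n] the high sum is strictly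
     negative. *)
  rewrite /gap subr_lt0; have [mj|jm] := ltnP m j.
    apply: le_lt_trans (Lpos j mj); rewrite HE subr_le0 lez_nat.
    exact: (high_digits_le K _ _ ae ad eK dK n).
  apply: lt_le_trans (L0 j); rewrite HE subr_lt0 ltz_nat.
  by apply: (high_digits_lt K _ _ ae ad eK dK n) => //; lia.
- rewrite (sum_digits_sub K d e (fun i => u (i + j))) subr_lt0 ltz_nat.
  exact: (shifted_digits_lt K _ _ ae ad dK n).
Qed.

(** * Transfer to integers and the function [f] *)

Lemma digits_vanish a : exists K, forall i, (K <= i)%N -> digits a i = 0%N.
Proof.
exists (\max_(j <- finsupp (digits a)) j).+1 => i lt_i; apply/eqP.
rewrite -memNfinsupp; apply/negP => i_supp.
have := @leq_bigmax_seq nat (enum_fset (finsupp (digits a))) predT id i i_supp isT.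
by rewrite leqNgt lt_i.
Qed.

Lemma f_ordE (R : realType) a K : (forall i, (K <= i)%N -> digits a i = 0%N) ->
  f R a = \sum_(i < K) (digits a i)%:R / (u i)%:R.
Proof.
move=> aK; rewrite /f -(big_mkord predT (fun i => (digits a i)%:R / (u i)%:R)).
pose s : {fset nat} := [fset i in index_iota 0 K]%fset.
have sub : (finsupp (digits a) `<=` s)%fset.
  apply/fsubsetP => i; rewrite mem_finsupp !inE mem_index_iota /=.
  by case: ltnP => // /aK ->; rewrite eqxx.
rewrite (big_fset_incl _ sub) => [|i _].
  by apply: perm_big; apply: uniq_perm;
    [exact: fset_uniq|exact: iota_uniq|move=> i; rewrite !inE].
by rewrite memNfinsupp => /eqP ->; rewrite mul0r.
Qed.

Lemma digits_sum a K : (forall i, (K <= i)%N -> digits a i = 0%N) ->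
  a = (\sum_(i < K) digits a i * u i)%N.
Proof. by move=> aK; rewrite -sum_finsupp //; have [_] := digitsP a. Qed.

(** The absolute values make the claim symmetric, so the number with the larger digit at the lowest
    difference may be put second. *)
Lemma distance_product_ge1 (R : realType) a b : a <> b ->
  1 <= `|b%:R - a%:R| * `|f R b - f R a|.
Proof.
move=> ab; have [K [aK bK]] : exists K,
    (forall i, (K <= i)%N -> digits a i = 0%N) /\
    (forall i, (K <= i)%N -> digits b i = 0%N).
  have [[n an] [m bm]] := (digits_vanish a, digits_vanish b).
  by exists (n + m)%N; split=> i hi; [apply: an|apply: bm]; lia.
have ex : exists i, digits a i != digits b i.
  apply: contrapT => no; apply: ab; rewrite (digits_sum _ _ aK) (digits_sum _ _ bK).
  apply: eq_bigr => i _; congr (_ * _)%N; apply/eqP.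
  by apply: contrapT => /negP ne; apply: no; exists (nat_of_ord i).
have [m nem mmin] := ex_minnP ex.
have {}mmin i : (i < m)%N -> digits a i = digits b i.
  by move=> im; apply/eqP; apply: contraTT im => /mmin; rewrite -leqNgt.
have [aa ba] : admissible (digits a) /\ admissible (digits b).
  by have [[? _] [? _]] := (digitsP a, digitsP b).
have key c d : admissible (digits c) -> admissible (digits d) ->
    (forall i, (K <= i)%N -> digits c i = 0%N) ->
    (forall i, (K <= i)%N -> digits d i = 0%N) ->
    (forall i, (i < m)%N -> digits c i = digits d i) -> (digits c m < digits d m)%N ->
    1 <= `|d%:R - c%:R| * `|f R d - f R c|.
  move=> ac ad cK dK mlt lt.
  have -> : d%:R - c%:R =
      \sum_(i < K) ((digits d i)%:Z - (digits c i)%:Z)%:~R * (u i)%:R :> R.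
    rewrite {1}(digits_sum d K dK) {1}(digits_sum c K cK) !natr_sum -sumrB.
    by apply: eq_bigr => i _; rewrite !natrM -mulrBl intrB.
  have -> : f R d - f R c =
      \sum_(i < K) ((digits d i)%:Z - (digits c i)%:Z)%:~R / (u i)%:R.
    by rewrite !(f_ordE _ _ K) // -sumrB; apply: eq_bigr => i _; rewrite -mulrBl intrB.
  exact: (digit_estimate R K _ _ m).
move: nem; rewrite neq_ltn => /orP[lt|lt]; first exact: key.
rewrite distrC [X in _ * X]distrC; apply: key => // i im; exact/esym/mmin.
Qed.

Theorem theorem15 (R : realType) (a b : nat) (hab : a <> b)
    (hf : f R a < f R b) :
  1 / `|b%:R - a%:R| <= f R b - f R a.
Proof.
rewrite ler_pdivrMr; last first.
  by rewrite normr_gt0 subr_eq0 eqr_nat eq_sym; apply/eqP.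
rewrite mulrC -[X in _ * X]gtr0_norm ?subr_gt0 //.
exact: distance_product_ge1.
Qed.
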